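(* Let $\mu\in(0,\infty)$, let $m=m_n$ and let $n,m\to+\infty$ with $m/n\to\mu$. Assume that $P^{(n)}$ converges weakly to some probability measure $P$ on $\mathbb{Z}_+\times[0,1]$ and that $P^{(n)}_{10}$ converges to $P_{10}\in(0,\infty)$. Fix $s,t\in\mathbb{N}$, and $M>0$ such that $\mathbb{P}(X\le M)>0$, where $(X,Y)\sim P$. Let $K=\{k\in\{1,\dots,m\}:X_{n,k}\le M\}$ and define the graph $\hat G=([n],E(\hat G))$ with $$E(\hat G)=\bigcup_{k\in K}E(G_{n,k}).$$ Let $\hat d_i=\deg_{\hat G}(i)$. Then, as $n\to\infty$, $$\mathbb{P}(\hat d_1=s,\ \hat d_2=t)=\mathbb{P}(\hat d_1=s)\,\mathbb{P}(\hat d_2=t)+o(1).$$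
   Context: Notation: $\mathbb{Z}_+=\{0,1,2,\dots\}$, $[n]=\{1,\dots,n\}$; $\deg_G(i)$ is the number of nodes adjacent to $i$ in the graph $G$. Model: For each $n$, let $m=m_n$ be the number of layers and $P^{(n)}$ a probability measure on $\{0,\dots,n\}\times[0,1]$. The triples $(G_{n,k},X_{n,k},Y_{n,k})$, $k=1,\dots,m$, are mutually independent, where $(X_{n,k},Y_{n,k})$ has distribution $P^{(n)}$ (size and strength of layer $k$, possibly dependent on each other) and $G_{n,k}$ is a random undirected graph with node set contained in $[n]$ such that: given $(X_{n,k},Y_{n,k})$, $V(G_{n,k})$ is uniformly distributed on the subsets of $[n]$ of size $X_{n,k}$; and given $(V(G_{n,k}),X_{n,k},Y_{n,k})$, each unordered node pair of $V(G_{n,k})$ is linked in $G_{n,k}$ with probability $Y_{n,k}$, independently of other pairs. $P^{(n)}_{10}=\mathbb{E}(X_{n,k})$ and $P_{10}=\mathbb{E}(X)$ for $(X,Y)\sim P$. *)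

(* Defs.v *)
From HB Require Import structures.
From mathcomp Require Import all_boot all_order all_algebra.
From mathcomp Require Import all_classical all_reals all_analysis.
Set Implicit Arguments.
Unset Strict Implicit.
Unset Printing Implicit Defensive.
Import Order.TTheory GRing.Theory Num.Theory.
Import numFieldNormedType.Exports.
Local Open Scope classical_set_scope.
Local Open Scope ring_scope.

Section Graphs.
Variable n : nat.

Definition node_pairs (V : {set 'I_n}) : {set {set 'I_n}} :=
  [set e : {set 'I_n} | (e \subset V) && (#|e| == 2)]%SET.

(* Simple undirected graphs whose node set is contained in the vertex universe;
   the universe {1, ..., n} is encoded as 'I_n = {0, ..., n-1}. *)
Record graph := Graph {
  graph_val : {set 'I_n} * {set {set 'I_n}};
  _ : graph_val.2 \subset node_pairs graph_val.1 }.

HB.instance Definition _ := [isSub for graph_val].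
HB.instance Definition _ := [Finite of graph by <:].

Definition nodes (G : graph) : {set 'I_n} := (val G).1.
Definition edges (G : graph) : {set {set 'I_n}} := (val G).2.

(* As every edge has two elements, j = i does not contribute. *)
Definition deg (G : graph) (i : 'I_n) : nat :=
  #|[set j : 'I_n | [set i; j]%SET \in edges G]%SET|.

Lemma edges_sub (G : graph) : edges G \subset node_pairs (nodes G).
Proof. exact: valP G. Qed.

Lemma graph0_subproof :
  (finset.set0 : {set {set 'I_n}}) \subset node_pairs finset.set0.
Proof. exact: finset.sub0set. Qed.

HB.instance Definition _ := isPointed.Build graph
  (@Graph (finset.set0, finset.set0) graph0_subproof).

Lemma union_graph_subproof (I : finType) (K : {set I}) (G : I -> graph) :
  (\bigcup_(k in K) edges (G k))%SET \subset node_pairs finset.setT.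
Proof.
apply/finset.bigcupsP => k _; apply/fintype.subsetP => e /(fintype.subsetP (edges_sub _)).
by rewrite !finset.inE finset.subsetT => /andP[].
Qed.

Definition union_graph (I : finType) (K : {set I}) (G : I -> graph) : graph :=
  @Graph (finset.setT, (\bigcup_(k in K) edges (G k))%SET)
    (union_graph_subproof K G).

End Graphs.

(* Finite types of sets and graphs carry the discrete sigma-algebra. *)
HB.instance Definition _ (T : finType) :=
  isPointed.Build {set T} (@finset.set0 T).
HB.instance Definition _ (T : finType) :=
  @isMeasurable.Build default_measure_display {set T}
    discrete_measurable discrete_measurable0
    discrete_measurableC discrete_measurableU.
HB.instance Definition _ (n : nat) :=
  @isMeasurable.Build default_measure_display (graph n)
    discrete_measurable discrete_measurable0
    discrete_measurableC discrete_measurableU.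

Section Probability.
Context {R : realType} {d d' : measure_display}.
Context {T : measurableType d} {S : measurableType d'}.

Definition mutually_independent (Pr : probability T R)
    (I : finType) (Z : I -> T -> S) : Prop :=
  forall (J : {set I}) (D : I -> set S), (forall i, measurable (D i)) ->
    Pr (\bigcap_(i in [set` J]) Z i @^-1` D i)
    = (\prod_(i in J) Pr (Z i @^-1` D i))%E.

(* Almost surely, the conditional probability of A given Z equals f(Z). *)
Definition cond_prob_is (Pr : probability T R)
    (A : set T) (Z : T -> S) (f : S -> R) : Prop :=
  forall D : set S, measurable D ->
    Pr (A `&` Z @^-1` D) = (\int[Pr]_(w in Z @^-1` D) (f (Z w))%:E)%E.

End Probability.

Section Layers.
Context {R : realType}.

(* The spaces Z_+ x [0,1] and {0, ..., n} x [0,1] as subsets of nat * R. *)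
Definition layer_types : set (nat * R) := [set z | 0 <= z.2 <= 1].
Definition layer_types_upto (n : nat) : set (nat * R) :=
  [set z | (z.1 <= n)%N /\ 0 <= z.2 <= 1].

(* Weak convergence of probability measures concentrated on layer_types. *)
Definition weakly_converges (Pn : nat -> probability (nat * R)%type R)
    (P : probability (nat * R)%type R) : Prop :=
  forall f : nat * R -> R,
    {within layer_types, continuous f} ->
    (exists C : R, forall z, layer_types z -> `|f z| <= C) ->
    (\int[Pn n]_(z in layer_types) (f z)%:E)%E @[n --> \oo]
      --> (\int[P]_(z in layer_types) (f z)%:E)%E.

Definition mean_size (Q : probability (nat * R)%type R) : \bar R :=
  'E_Q[fun z => z.1%:R].

Context {n : nat} {d : measure_display} {T : measurableType d}.

Definition layer_graph (Z : T -> graph n * (nat * R)) (w : T) := (Z w).1.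
Definition layer_size (Z : T -> graph n * (nat * R)) (w : T) := (Z w).2.1.
Definition layer_strength (Z : T -> graph n * (nat * R)) (w : T) := (Z w).2.2.

(* Law of a triple Z = (G, X, Y).  The last clause expresses the conditional
   independence of the links by the product rule over every set F of pairs;
   pairs that are not contained in the node set are never linked. *)
Definition layer_law (Pr : probability T R) (Q : probability (nat * R)%type R)
    (Z : T -> graph n * (nat * R)) : Prop :=
  [/\ forall D : set (nat * R), measurable D ->
        Pr [set w | D (layer_size Z w, layer_strength Z w)] = Q D,
      forall A : {set 'I_n},
        cond_prob_is Pr [set w | nodes (layer_graph Z w) = A]
          (fun w => (layer_size Z w, layer_strength Z w))
          (fun xy => if #|A| == xy.1 then ('C(n, xy.1)%:R)^-1 else 0)
    & forall F : {set {set 'I_n}},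
        cond_prob_is Pr [set w | F \subset edges (layer_graph Z w)]
          (fun w => (nodes (layer_graph Z w),
                     (layer_size Z w, layer_strength Z w)))
          (fun vxy => if F \subset node_pairs vxy.1
                      then \prod_(e in F) vxy.2.2 else 0)].

Definition truncated_layers (m : nat) (Z : 'I_m -> T -> graph n * (nat * R))
    (M : R) (w : T) : {set 'I_m} :=
  [set k : 'I_m | (layer_size (Z k) w)%:R <= M]%SET.

Definition truncated_graph (m : nat) (Z : 'I_m -> T -> graph n * (nat * R))
    (M : R) (w : T) : graph n :=
  union_graph (truncated_layers Z M w) (fun k => layer_graph (Z k) w).

End Layers.

(* Main.v *)
(** The layers are independent, so the joint law of the degrees of nodes i and j is
    an image of the product over k of the laws of the pairs (N_i, N_j) of
    neighbourhoods in layer k (empty if the layer is larger than M).  Replacing each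
    of these laws by the product of its marginals makes the two degrees independent,
    and changes the product law in L1 by at most the sum of the changes of the
    factors.  As a layer of size at most M contains i with probability at most M/n, and
    both i and j with probability at most M^2/(n(n-1)), every factor changes by
    O(1/n^2); with m = O(n) layers the total change is O(1/n). *)
Require Import Defs.
From mathcomp Require Import all_boot all_order all_algebra.
From mathcomp Require Import all_classical all_reals all_analysis.
From mathcomp Require Import perm ring lra.
Set Implicit Arguments.
Unset Strict Implicit.
Unset Printing Implicit Defensive.
Import Order.TTheory GRing.Theory Num.Theory.
Import numFieldNormedType.Exports.
Local Open Scope classical_set_scope.
Local Open Scope ring_scope.

(** * L1 distances between finite product laws *)

(* Hybrid argument: switch the factors from x to y one at a time. *)
Lemma prodrB (R : comNzRingType) (m : nat) (x y : 'I_m -> R) :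
  \prod_j x j - \prod_j y j =
  \sum_(k < m) \prod_(j < m) (if (j < k)%N then y j
                  else if j == k then x j - y j else x j).
Proof.
elim: m x y => [|m IHm] x y; first by rewrite !big_ord0 subrr.
pose w := widen_ord (leqnSn m).
(* For [k < m] the last index lies beyond [k] and still carries [x]; only in the term [k = m] does
   it carry the difference. *)
have w_term (k : 'I_m) : \prod_(j < m.+1) (if (j < w k)%N then y j
      else if j == w k then x j - y j else x j) =
    (\prod_(j < m) (if (j < k)%N then y (w j)
      else if j == k then x (w j) - y (w j) else x (w j))) * x ord_max.
  rewrite big_ord_recr /= ltnNge (ltnW (ltn_ord k)) /=.
  by rewrite -val_eqE /= gtn_eqF.
have max_term : \prod_(j < m.+1) (if (j < @ord_max m)%N then y j
      else if j == ord_max then x j - y j else x j) =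
    (\prod_(j < m) y (w j)) * (x ord_max - y ord_max).
  rewrite big_ord_recr /= ltnn eqxx; congr (_ * _).
  by apply: eq_bigr => j _; rewrite ltn_ord.
rewrite [RHS]big_ord_recr max_term (eq_bigr _ (fun k _ => w_term k)) -mulr_suml.
by rewrite -(IHm (x \o w) (y \o w)) !big_ord_recr /=; ring.
Qed.

(** Summed over all [v], the [k]-th hybrid term splits into a product over coordinates. Each
    coordinate other than [k] carries a probability law and contributes 1, so only the L1 distance
    at [k] remains. *)
Lemma dist_prod_le (R : realDomainType) (m : nat) (U : finType)
    (p q : 'I_m -> U -> R)
    (p_ge0 : forall k u, 0 <= p k u) (q_ge0 : forall k u, 0 <= q k u)
    (p_sum1 : forall k, \sum_u p k u = 1) (q_sum1 : forall k, \sum_u q k u = 1) :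
  \sum_(v : {ffun 'I_m -> U}) `|\prod_k p k (v k) - \prod_k q k (v k)|
  <= \sum_k \sum_u `|p k u - q k u|.
Proof.
pose r (k j : 'I_m) (u : U) := if (j < k)%N then q j u
                else if j == k then p j u - q j u else p j u.
have r_sum (k j : 'I_m) : \sum_u `|r k j u| =
    if j == k then \sum_u `|p j u - q j u| else 1.
  rewrite /r; case: ltngtP => [jk|kj|/val_inj ->]; last by rewrite eqxx.
  - rewrite -val_eqE ltn_eqF //= -(q_sum1 j).
    by apply: eq_bigr => u _; rewrite ger0_norm.
  - rewrite -val_eqE gtn_eqF //= -(p_sum1 j).
    by apply: eq_bigr => u _; rewrite ger0_norm.
have -> : \sum_k \sum_u `|p k u - q k u| =
    \sum_k \sum_(v : {ffun 'I_m -> U}) \prod_j `|r k j (v j)|.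
  apply: eq_bigr => k _; rewrite -(bigA_distr_bigA (fun j u => `|r k j u|)).
  rewrite (bigD1 k) //= r_sum eqxx [X in _ * X]big1 ?mulr1 // => j /negbTE jk.
  by rewrite r_sum jk.
rewrite exchange_big /=; apply: ler_sum => v _.
rewrite prodrB (le_trans (ler_norm_sum _ _ _)) //.
by apply: ler_sum => k _; rewrite normr_prod.
Qed.

(** Useful when [a0] and [b0] carry nearly all of the mass: below they are empty neighbourhoods, and
    the bound is of second order. *)
Lemma dist_product_of_marginals (R : realDomainType) (A B : finType)
    (p : A * B -> R) (pA : A -> R) (pB : B -> R) (a0 : A) (b0 : B)
    (pAE : forall a, pA a = \sum_b p (a, b)) (pBE : forall b, pB b = \sum_a p (a, b))
    (p_ge0 : forall u, 0 <= p u) (p_sum1 : \sum_u p u = 1) :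
  \sum_u `|p u - pA u.1 * pB u.2| <=
  ((\sum_(u | (u.1 != a0) && (u.2 != b0)) p u) +
   (\sum_(a | a != a0) pA a) * (\sum_(b | b != b0) pB b)) *+ 4.
Proof.
pose c a b := p (a, b) - pA a * pB b.
have pA_sum1 : \sum_a pA a = 1.
  by rewrite (eq_bigr _ (fun a _ => pAE a)) -p_sum1 pair_bigA; apply: eq_bigr => -[].
have pB_sum1 : \sum_b pB b = 1.
  rewrite (eq_bigr _ (fun b _ => pBE b)) exchange_big pair_bigA /= -p_sum1.
  by apply: eq_bigr => -[].
(* [c] has zero row and column sums, so its entries in row [a0] and column [b0]
   are controlled by those outside of them. *)
have cA a : \sum_b c a b = 0.
  by rewrite /c big_split /= sumrN -mulr_sumr pB_sum1 mulr1 pAE subrr.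
have cB b : \sum_a c a b = 0.
  by rewrite /c big_split /= sumrN -mulr_suml pA_sum1 mul1r pBE subrr.
pose D := \sum_(a | a != a0) \sum_(b | b != b0) `|c a b|.
have D_row b : `|c a0 b| <= \sum_(a | a != a0) `|c a b|.
  move: (cB b); rewrite (bigD1 a0) //= => /eqP; rewrite addr_eq0 => /eqP ->.
  by rewrite normrN ler_norm_sum.
have D_col a : `|c a b0| <= \sum_(b | b != b0) `|c a b|.
  move: (cA a); rewrite (bigD1 b0) //= => /eqP; rewrite addr_eq0 => /eqP ->.
  by rewrite normrN ler_norm_sum.
have row_le : \sum_(b | b != b0) `|c a0 b| <= D.
  by rewrite /D exchange_big /=; apply: ler_sum => b _; exact: D_row.
have col_le : \sum_(a | a != a0) `|c a b0| <= D.
  by apply: ler_sum => a _; exact: D_col.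
have corner_le : `|c a0 b0| <= D by exact: le_trans (D_col a0) row_le.
(* Corner, row, column and remainder each have mass at most [D], whence the factor 4. *)
have sum_le : \sum_u `|p u - pA u.1 * pB u.2| <= D *+ 4.
  rewrite (_ : \sum_u _ = \sum_a \sum_b `|c a b|); last first.
    by rewrite pair_bigA; apply: eq_bigr => -[].
  rewrite (bigD1 a0) //= (bigD1 b0) //=.
  rewrite [X in _ + X](eq_bigr (fun a => `|c a b0| + \sum_(b | b != b0) `|c a b|));
    last by move=> a _; rewrite (bigD1 b0).
  rewrite big_split /= -/D.
  rewrite !mulrS mulr0n addr0; lra.
(* It remains to bound [D], by the triangle inequality in each entry; the product terms then sum to
   a product of sums. *)
apply: le_trans sum_le _; rewrite lerMn2r /=.
have -> : \sum_(u | (u.1 != a0) && (u.2 != b0)) p u =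
    \sum_(a | a != a0) \sum_(b | b != b0) p (a, b).
  by rewrite pair_big /=; apply: eq_bigr => -[].
rewrite mulr_suml -big_split; apply: ler_sum => a _ /=.
rewrite mulr_sumr -big_split; apply: ler_sum => b _ /=.
rewrite (le_trans (ler_normB _ _)) // !ger0_norm //.
by rewrite pAE pBE mulr_ge0 // sumr_ge0.
Qed.

(** The product of the two marginal probabilities is the probability of the joint event under the
    law with factors [pA * pB]. Two laws differ on an event by at most their L1 distance, which
    [dist_prod_le] splits over [k]. *)
Lemma joint_event_dist_le (R : realDomainType) (m : nat) (A B : finType)
    (p : 'I_m -> A * B -> R) (pA : 'I_m -> A -> R) (pB : 'I_m -> B -> R)
    (E : pred {ffun 'I_m -> A}) (F : pred {ffun 'I_m -> B})
    (pAE : forall k a, pA k a = \sum_b p k (a, b))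
    (pBE : forall k b, pB k b = \sum_a p k (a, b))
    (p_ge0 : forall k u, 0 <= p k u) (p_sum1 : forall k, \sum_u p k u = 1) :
  `|\sum_(v : {ffun 'I_m -> A * B} |
       E [ffun k => (v k).1] && F [ffun k => (v k).2]) \prod_k p k (v k)
    - (\sum_(a : {ffun 'I_m -> A} | E a) \prod_k pA k (a k)) *
      (\sum_(b : {ffun 'I_m -> B} | F b) \prod_k pB k (b k))|
  <= \sum_k \sum_u `|p k u - pA k u.1 * pB k u.2|.
Proof.
pose EF (v : {ffun 'I_m -> A * B}) := E [ffun k => (v k).1] && F [ffun k => (v k).2].
have pA_sum1 k : \sum_a pA k a = 1.
  rewrite (eq_bigr _ (fun a _ => pAE k a)) -(p_sum1 k) pair_bigA.
  by apply: eq_bigr => -[].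
have pB_sum1 k : \sum_b pB k b = 1.
  rewrite (eq_bigr _ (fun b _ => pBE k b)) exchange_big pair_bigA /= -(p_sum1 k).
  by apply: eq_bigr => -[].
have -> : (\sum_(a : {ffun 'I_m -> A} | E a) \prod_k pA k (a k)) *
      (\sum_(b : {ffun 'I_m -> B} | F b) \prod_k pB k (b k)) =
    \sum_(v | EF v) \prod_k (pA k (v k).1 * pB k (v k).2).
  rewrite mulr_suml; under eq_bigr do rewrite mulr_sumr.
  rewrite pair_big /=.
  pose zip (ab : {ffun 'I_m -> A} * {ffun 'I_m -> B}) := [ffun k => (ab.1 k, ab.2 k)].
  pose unzip (v : {ffun 'I_m -> A * B}) := ([ffun k => (v k).1], [ffun k => (v k).2]).
  rewrite [RHS](reindex zip); last first.
    exists unzip => [[a b]|v] _; last first.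
      by apply/ffunP => k; rewrite !ffunE -surjective_pairing.
    by congr (_, _); apply/ffunP => k; rewrite !ffunE.
  apply: eq_big => [[a b]|[a b] _]; last first.
    by rewrite -big_split; apply: eq_bigr => k _; rewrite ffunE.
  by rewrite /EF; congr (E _ && F _); apply/ffunP => k; rewrite !ffunE.
rewrite -sumrB (le_trans (ler_norm_sum _ _ _)) //.
apply: le_trans (dist_prod_le p_ge0 _ p_sum1 _); last first.
- move=> k; rewrite -[RHS](pA_sum1 k) -(pair_bigA _ (fun a b => pA k a * pB k b)).
  by apply: eq_bigr => a _; rewrite -mulr_sumr pB_sum1 mulr1.
- by move=> k u; rewrite pAE pBE mulr_ge0 // sumr_ge0.
by rewrite [leRHS](bigID EF) /= lerDl sumr_ge0.
Qed.

(** * Exchangeable random sets of size at most [M] *)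

Section ExchangeableSets.
Variables (R : realDomainType) (T : finType) (g : {set T} -> R) (M : R).
Hypothesis g_ge0 : forall A, 0 <= g A.
Hypothesis g_card : forall A B : {set T}, #|A| = #|B| -> g A = g B.
Hypothesis g_supp : forall A : {set T}, M < #|A|%:R -> g A = 0.

Lemma sum_perm_set (s : {perm T}) (Q : pred {set T}) :
  \sum_(A | Q A) g A = \sum_(A : {set T} | Q (s @: A)%SET) g A.
Proof.
rewrite (reindex_inj (imset_inj (@perm_inj _ s))).
by apply: eq_bigr => A _; apply: g_card; rewrite card_imset //; exact: perm_inj.
Qed.

Lemma double_counting (S : {set T}) (Q : pred {set T}) :
  \sum_(i in S) \sum_(B : {set T} | Q B && (i \in B)) g B =
  \sum_(B : {set T} | Q B) g B *+ #|B :&: S|.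
Proof.
under eq_bigr do rewrite big_mkcondr.
rewrite exchange_big; apply: eq_bigr => B _ /=.
rewrite -big_mkcondr sumr_const; congr (_ *+ _).
by apply: eq_card => i; rewrite !inE andbC.
Qed.

Lemma mass_card_le (S A : {set T}) : g A *+ #|A :&: S| <= M * g A.
Proof.
have [lt|ge] := ltP M #|A|%:R; first by rewrite g_supp // mul0rn mulr0.
rewrite -mulr_natl ler_wpM2r //; apply: le_trans ge.
by rewrite ler_nat subset_leq_card // subsetIl.
Qed.

(** A transposition shows that every point is included with the same probability. The sum of these
    over all points is the mean size, at most [M]. *)
Lemma inclusion_le (i : T) (g_sum : \sum_A g A <= 1) (M_ge0 : 0 <= M) :
  (\sum_(A : {set T} | i \in A) g A) *+ #|T| <= M.
Proof.
have <- : \sum_(j in [set: T]%SET) \sum_(A : {set T} | xpredT A && (j \in A)) g A =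
    (\sum_(A : {set T} | i \in A) g A) *+ #|T|.
  rewrite -cardsT -sumr_const; apply: eq_bigr => j _.
  rewrite (sum_perm_set (tperm i j)); apply: eq_bigl => A /=.
  by rewrite -{1}(tpermL i j) mem_imset //; exact: perm_inj.
rewrite double_counting; apply: le_trans (ler_sum _ (fun A _ => mass_card_le _ A)) _.
by rewrite -mulr_sumr ler_piMr.
Qed.

(** The same count among the sets containing [i]: the second point ranges over the [#|T|.-1] others,
    moved by transpositions that fix [i]. *)
Lemma pair_inclusion_le (i j : T) (ij : i != j) :
  (\sum_(A : {set T} | (i \in A) && (j \in A)) g A) *+ #|T|.-1 <=
  M * \sum_(A : {set T} | i \in A) g A.
Proof.
have <- : \sum_(k in [set~ i]%SET) \sum_(A : {set T} | (i \in A) && (k \in A)) g A =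
    (\sum_(A : {set T} | (i \in A) && (j \in A)) g A) *+ #|T|.-1.
  rewrite -(cardsC1 i) -sumr_const; apply: eq_bigr => k.
  rewrite !inE eq_sym => ik.
  rewrite (sum_perm_set (tperm j k)); apply: eq_bigl => A /=.
  rewrite -{2}(tpermL j k) -{1}(tpermD (x := j) (y := k) (z := i)) 1?eq_sym //.
  by rewrite !mem_imset //; exact: perm_inj.
rewrite double_counting; apply: le_trans (ler_sum _ (fun A _ => mass_card_le _ A)) _.
by rewrite -mulr_sumr.
Qed.

End ExchangeableSets.

(** * Finite-valued random variables and their point masses *)

Section FiniteValued.
Context {R : realType} {d d' : measure_display}.
Context {T : measurableType d} {S : measurableType d'} (Pr : probability T R).

Lemma measurable_fin_valued (U : finType) (f : T -> U) (Q : pred U)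
    (mf : forall u, measurable (f @^-1` [set u])) : measurable [set w | Q (f w)].
Proof.
rewrite (_ : [set w | _] = \bigcup_(u in [set` Q]) f @^-1` [set u]).
  exact: fin_bigcup_measurable.
by apply/seteqP; split=> w /=; [exists (f w) | case=> u /= Qu ->].
Qed.

Lemma prob_fin_valued (U : finType) (f : T -> U) (Q : pred U)
    (mf : forall u, measurable (f @^-1` [set u])) :
  fine (Pr [set w | Q (f w)]) = \sum_(u | Q u) fine (Pr (f @^-1` [set u])).
Proof.
have -> : [set w | Q (f w)] = \bigcup_(u in [set` Q]) f @^-1` [set u].
  by apply/seteqP; split=> w /=; [exists (f w) | case=> u /= Qu ->].
rewrite measure_fin_bigcup //; last exact: trivIset_preimage1.
rewrite -(@bigfs _ _ _ _ (index_enum U)) ?index_enum_uniq //; last first.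
  by move=> u _; rewrite mem_index_enum.
rewrite (eq_bigr (fun u => (fine (Pr (f @^-1` [set u])))%:E)) ?sumEFin //.
by move=> u _; rewrite fineK // fin_num_measure.
Qed.

Lemma prob_fin_valued_le (U U' : finType) (f : T -> U) (f' : T -> U')
    (Q : pred U) (Q' : pred U')
    (mf : forall u, measurable (f @^-1` [set u]))
    (mf' : forall u, measurable (f' @^-1` [set u])) :
  (forall w, Q (f w) -> Q' (f' w)) ->
  \sum_(u | Q u) fine (Pr (f @^-1` [set u])) <=
  \sum_(u | Q' u) fine (Pr (f' @^-1` [set u])).
Proof.
move=> QQ'; rewrite -!prob_fin_valued //.
have mQ := measurable_fin_valued Q mf; have mQ' := measurable_fin_valued Q' mf'.
by apply: fine_le; rewrite ?fin_num_measure // le_measure ?inE.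
Qed.

Lemma prob_ge0 (A : set T) : 0 <= fine (Pr A).
Proof. exact: fine_ge0. Qed.

Lemma prob_fin_valued_sum1 (U : finType) (f : T -> U)
    (mf : forall u, measurable (f @^-1` [set u])) :
  \sum_u fine (Pr (f @^-1` [set u])) = 1.
Proof.
rewrite -(@prob_fin_valued _ _ xpredT) //.
by rewrite (_ : [set w | _] = setT) ?probability_setT //; apply/seteqP; split.
Qed.

(** A fibre of the vector is the intersection of the fibres of its coordinates, so independence
    turns each point mass into a product. *)
Lemma prob_independent_fin_valued (I U : finType) (Z : I -> {RV Pr >-> S}) (h : S -> U)
    (Q : pred {ffun I -> U})
    (indep : mutually_independent Pr (fun i => Z i : T -> S))
    (mh : forall u, measurable (h @^-1` [set u])) :
  fine (Pr [set w | Q [ffun i => h (Z i w)]]) =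
  \sum_(v | Q v) \prod_i fine (Pr ((h \o Z i) @^-1` [set v i])).
Proof.
have mhZ i u : measurable ((h \o Z i) @^-1` [set u]).
  by rewrite comp_preimage -[X in measurable X]setTI; exact: measurable_funP.
pose f w := [ffun i => h (Z i w)].
have fE v : f @^-1` [set v] =
    \bigcap_(i in [set` [set: I]%SET]) Z i @^-1` (h @^-1` [set v i]).
  apply/seteqP; split=> [w /= <- i _|w /= hw]; first by rewrite /= ffunE.
  by apply/ffunP => i; rewrite ffunE; apply: hw; rewrite /= inE.
rewrite (@prob_fin_valued _ f).
  apply: eq_bigr => v _; rewrite fE indep //.
  rewrite (eq_bigr (fun i => (fine (Pr ((h \o Z i) @^-1` [set v i])))%:E)).
    by rewrite prodEFin /=; apply: eq_bigl => i; rewrite inE.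
  by move=> i _; rewrite fineK // fin_num_measure.
move=> v; rewrite fE; apply: fin_bigcap_measurable => [|i _]; last exact: mhZ.
exact: finite_finset.
Qed.

End FiniteValued.

(** * Neighbourhoods in a truncated layer *)

Definition neighbours (n : nat) (i : 'I_n) (G : graph n) : {set 'I_n} :=
  [set j | [set i; j]%SET \in edges G]%SET.

(** Giving large layers the default value [c] replaces the random index set of retained layers by
    the fixed set of all layers. *)
Definition if_small {R : realType} {n : nat} {U : Type} (M : R) (c : U)
    (f : graph n -> U) (z : graph n * (nat * R)) : U :=
  if z.2.1%:R <= M then f z.1 else c.

Lemma measurable_if_small (R : realType) (n : nat) (U : Type) (M : R) (c : U)
    (f : graph n -> U) (u : U) : measurable (if_small M c f @^-1` [set u]).
Proof.
have mM : measurable [set z : graph n * (nat * R) | z.2.1%:R <= M].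
  have := measurableT_comp (@measurable_fst _ _ nat R)
    (@measurable_snd _ _ (graph n) (nat * R)%type).
  move=> /(_ measurableT [set k | k%:R <= M] I).
  by rewrite setTI.
have mf : measurable [set z : graph n * (nat * R) | f z.1 = u].
  have := @measurable_fst _ _ (graph n) (nat * R)%type measurableT [set G | f G = u] I.
  by rewrite setTI.
rewrite (_ : _ @^-1` _ = ([set z | z.2.1%:R <= M] `&` [set z | f z.1 = u]) `|`
    (~` [set z | z.2.1%:R <= M] `&` [set _ | c = u])).
  apply: measurableU; apply: measurableI => //; first exact: measurableC.
  have [cu|cu] := pselect (c = u).
    by rewrite (_ : [set _ | _] = setT) //; apply/seteqP; split.
  by rewrite (_ : [set _ | _] = set0) //; apply/seteqP; split.
rewrite /if_small; apply/seteqP; split=> z /=; case: ifP => zM.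
- by left.
- by right; split=> //; rewrite zM.
- by case=> -[].
- by case=> -[].
Qed.

(** A discarded layer contributes the empty neighbourhood, so the union may run over all layers. *)
Lemma deg_truncated_graph (R : realType) (n m : nat) (d : measure_display)
    (T : measurableType d) (Z : 'I_m -> T -> graph n * (nat * R))
    (M : R) (w : T) (i : 'I_n) :
  deg (truncated_graph Z M w) i =
  #|\bigcup_k if_small M finset.set0 (neighbours i) (Z k w)|%SET.
Proof.
apply: eq_card => j; rewrite !inE /edges /=.
apply/bigcupP/bigcupP => -[k].
  by rewrite inE => zM ij; exists k => //; rewrite /if_small zM inE.
rewrite /if_small => _; case: ifP => zM; rewrite !inE // => ij.
by exists k => //; rewrite inE.
Qed.

(** * Probability bounds for one layer *)

Section LayerBounds.
Context {R : realType} {n : nat} {d : measure_display} {T : measurableType d}.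
Variables (Pr : probability T R) (Q : probability (nat * R)%type R).
Variables (Z : {RV Pr >-> (graph n * (nat * R))%type}) (M : R).
Hypotheses (Zlaw : layer_law Pr Q Z) (M_gt0 : 0 < M).

Let fiber (U : Type) (c : U) (f : graph n -> U) (u : U) :=
  (if_small M c f \o Z) @^-1` [set u].

Lemma measurable_fiber (U : Type) (c : U) (f : graph n -> U) (u : U) :
  measurable (fiber c f u).
Proof.
rewrite /fiber comp_preimage -[X in measurable X]setTI.
by apply: measurable_funP => //; exact: measurable_if_small.
Qed.

Let g (A : {set 'I_n}) := fine (Pr (fiber finset.set0 (@nodes n) A)).

(** The empty set is excluded because it also receives the mass of the layers larger than [M]. The
    right-hand side depends on [A] only through its cardinality, which gives exchangeability. *)
Lemma node_set_probE (A : {set 'I_n}) : A != finset.set0 ->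
  g A = fine (\int[Pr]_(w in [set w | (layer_size Z w)%:R <= M]%R)
    (if #|A| == layer_size Z w then ('C(n, layer_size Z w)%:R)^-1 else 0)%R%:E)%E.
Proof.
move=> A0; have [_ law_nodes _] := Zlaw.
have mD : measurable [set z : nat * R | z.1%:R <= M].
  by have := @measurable_fst _ _ nat R measurableT [set k | k%:R <= M] I; rewrite setTI.
have <- := law_nodes A _ mD.
rewrite /g; congr (fine (Pr _)); apply/seteqP; split=> w /=.
  rewrite /fiber /if_small /= /layer_size /layer_graph; case: ifP => // _ A_0.
  by rewrite -A_0 eqxx in A0.
by rewrite /fiber /if_small /= /layer_size /layer_graph => -[-> ->].
Qed.

Lemma node_set_prob_card (A B : {set 'I_n}) : #|A| = #|B| -> g A = g B.
Proof.
(* The exceptional empty set is harmless: no other set has cardinality 0. *)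
move=> AB; have [A0|A0] := eqVneq A finset.set0.
  by move: AB; rewrite A0 cards0 => /esym/eqP; rewrite cards_eq0 => /eqP ->.
by rewrite !node_set_probE ?AB // -cards_eq0 -AB cards_eq0.
Qed.

Lemma node_set_prob_supp (A : {set 'I_n}) : M < #|A|%:R -> g A = 0.
Proof.
move=> MA; rewrite node_set_probE; last first.
  by rewrite -cards_eq0 -lt0n -(ltr_nat R) (lt_trans M_gt0 MA).
rewrite integral0_eq // => w /= XM; case: ifP => // /eqP AX.
by move: MA; rewrite AX ltNge XM.
Qed.

Lemma node_set_prob_sum : \sum_A g A <= 1.
Proof. by rewrite /g prob_fin_valued_sum1 // => u; exact: measurable_fiber. Qed.

Lemma node_inclusion_le (i : 'I_n) : (\sum_(A : {set 'I_n} | i \in A) g A) *+ n <= M.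
Proof.
have g_ge0 A : 0 <= g A by exact: prob_ge0.
have := inclusion_le g_ge0 node_set_prob_card node_set_prob_supp i.
by rewrite card_ord => -> //; [exact: node_set_prob_sum | exact: ltW].
Qed.

Let p i j u := fine (Pr (fiber (finset.set0, finset.set0)
  (fun G => (neighbours i G, neighbours j G)) u)).
Let q i a := fine (Pr (fiber finset.set0 (neighbours i) a)).

Lemma nodes_neighbours (i : 'I_n) (G : graph n) :
  neighbours i G != finset.set0 -> i \in nodes G.
Proof.
case/finset.set0Pn => j; rewrite inE => /(fintype.subsetP (edges_sub G)).
by rewrite inE => /andP[/fintype.subsetP /(_ i) + _]; apply; rewrite !inE eqxx.
Qed.

(** A node with a neighbour in the layer belongs to its node set. *)
Lemma neighbours_prob_le (i : 'I_n) :
  (\sum_(a | a != finset.set0) q i a) *+ n <= M.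
Proof.
apply: le_trans (node_inclusion_le i).
rewrite lerMn2r; apply/orP; right.
apply: prob_fin_valued_le => [u|u|w /=]; do ?exact: measurable_fiber.
by rewrite /if_small; case: ifP; rewrite ?eqxx // => _ /nodes_neighbours.
Qed.

(** Both nodes must lie in the node set: the first costs a factor [M / n], the second a factor
    [M / (n - 1)]. *)
Lemma neighbours_pair_prob_le (i j : 'I_n) : i != j ->
  (\sum_(u | (u.1 != finset.set0) && (u.2 != finset.set0)) p i j u)
    *+ (n * n.-1) <= M ^+ 2.
Proof.
move=> ij.
pose x := \sum_(A : {set 'I_n} | i \in A) g A.
have x_le : x *+ n <= M by exact: node_inclusion_le.
have g_ge0 A : 0 <= g A by exact: prob_ge0.
have := pair_inclusion_le g_ge0 node_set_prob_card node_set_prob_supp ij.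
rewrite card_ord => xy.
apply: (@le_trans _ _ (M * x *+ n)); last by rewrite -mulrnAr expr2 ler_pM2l.
rewrite mulnC mulrnA lerMn2r; apply/orP; right.
apply: le_trans xy.
rewrite lerMn2r; apply/orP; right.
apply: prob_fin_valued_le => [u|u|w /=]; do ?exact: measurable_fiber.
rewrite /if_small; case: ifP; rewrite ?eqxx // => _.
by move=> /andP[/nodes_neighbours -> /nodes_neighbours].
Qed.

(** The default of the pair is the pair of defaults, so projection commutes with truncation. *)
Lemma neighbours_fst_marginal i j a : q i a = \sum_b p i j (a, b).
Proof.
have -> : \sum_b p i j (a, b) = \sum_(u | (u.1 == a) && true) p i j u.
  rewrite [RHS](eq_bigr (fun u => p i j (u.1, u.2))); last by case.
  by rewrite -(pair_big (pred1 a) xpredT (fun a b => p i j (a, b))) /= big_pred1_eq.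
rewrite /p -(@prob_fin_valued _ _ _ _ _ _ (fun u => (u.1 == a) && true)).
  congr (fine (Pr _)); apply/seteqP.
  by rewrite /fiber /if_small; split=> w /=; case: ifP => _ /=;
    [move=> ->; rewrite eqxx | move=> ->; rewrite eqxx
    | rewrite andbT => /eqP | rewrite andbT => /eqP].
by move=> u; exact: measurable_fiber.
Qed.

Lemma neighbours_snd_marginal i j b : q j b = \sum_a p i j (a, b).
Proof.
rewrite (neighbours_fst_marginal j i); apply: eq_bigr => a _.
rewrite /p; congr (fine (Pr _)); rewrite /fiber /if_small.
by apply/seteqP; split=> w /=; case: ifP => _ -[-> ->].
Qed.

Lemma neighbours_dist_le (i j : 'I_n) : i != j ->
  \sum_u `|p i j u - q i u.1 * q j u.2| <= M ^+ 2 / (n * n.-1)%:R *+ 8.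
Proof.
(* Two distinct nodes exist, so the denominator [n * n.-1] is positive. *)
move=> ij; have n_gt1 : (1 < n)%N.
  case: n i j ij => [|[|n']] // [a a_lt] [b b_lt]; first by [].
  by rewrite -val_eqE /=; case: a b a_lt b_lt => [|//] [].
apply: le_trans.
  apply: (dist_product_of_marginals finset.set0 finset.set0).
  - exact: (neighbours_fst_marginal i j).
  - exact: neighbours_snd_marginal.
  - by move=> u; exact: prob_ge0.
  - by apply: prob_fin_valued_sum1 => u; exact: measurable_fiber.
have nn_gt0 : 0 < (n * n.-1)%:R :> R.
  by rewrite ltr0n muln_gt0 (ltnW n_gt1) -ltnS prednK // ltnW.
(* The 8 is the factor 4 of [dist_product_of_marginals] times its two terms, each at most
   [M ^+ 2 / (n * n.-1)]. *)
rewrite -[8%N]/(2 * 4)%N mulrnA lerMn2r /= mulr2n lerD //.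
  by rewrite ler_pdivlMr // mulr_natr; exact: neighbours_pair_prob_le.
rewrite ler_pdivlMr //.
set a := \sum_(_ | _) _; set b := \sum_(_ | _) _.
have a_ge0 : 0 <= a by apply: sumr_ge0 => u _; exact: prob_ge0.
have b_ge0 : 0 <= b by apply: sumr_ge0 => u _; exact: prob_ge0.
(* The product of the marginals is even at most [M ^+ 2 / n ^+ 2]; the weaker denominator matches
   the joint term. *)
apply: (@le_trans _ _ ((a *+ n) * (b *+ n))).
  rewrite -(mulr_natr a) -(mulr_natr b) mulrACA -natrM ler_wpM2l ?mulr_ge0 //.
  by rewrite ler_nat leq_mul2l leq_pred orbT.
by rewrite expr2 ler_pM ?mulrn_wge0 //; exact: neighbours_prob_le.
Qed.

End LayerBounds.

(** * Asymptotic independence of the two degrees *)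

Definition truncated_deg {R : realType} {n m : nat} {d : measure_display}
    {T : measurableType d}
    (Z : 'I_m -> T -> graph n * (nat * R)) (M : R) (i : 'I_n) (w : T) : nat :=
  deg (truncated_graph Z M w) i.

(** Each degree is a function of the vector of neighbourhoods of its node in the [m] independent
    layers, so the one-layer bounds add up. *)
Lemma degree_dependence_le (R : realType) (n m : nat) (d : measure_display)
    (T : measurableType d) (Pr : probability T R) (Q : probability (nat * R)%type R)
    (Z : 'I_m -> {RV Pr >-> (graph n * (nat * R))%type}) (M : R)
    (i j : 'I_n) (s t : nat)
    (Zlaw : forall k, layer_law Pr Q (Z k))
    (indep : mutually_independent Pr (fun k => Z k : T -> _))
    (M_gt0 : 0 < M) (ij : i != j) :
  `|fine (Pr [set w | truncated_deg Z M i w = s /\ truncated_deg Z M j w = t])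
    - fine (Pr [set w | truncated_deg Z M i w = s])
      * fine (Pr [set w | truncated_deg Z M j w = t])| <=
  M ^+ 2 / (n * n.-1)%:R *+ 8 *+ m.
Proof.
pose hasdeg (r : nat) (a : {ffun 'I_m -> {set 'I_n}}) := #|\bigcup_k a k|%SET == r.
have hasdegE r l w (a : {ffun 'I_m -> {set 'I_n}}) :
    (forall k, a k = if_small M finset.set0 (neighbours l) (Z k w)) ->
    hasdeg r a = (truncated_deg Z M l w == r).
  move=> aE; rewrite /hasdeg /truncated_deg deg_truncated_graph.
  by rewrite (eq_bigr _ (fun k _ => aE k)).
have marginal (l : 'I_n) r : fine (Pr [set w | truncated_deg Z M l w = r]) =
    \sum_(a | hasdeg r a) \prod_k
      fine (Pr ((if_small M finset.set0 (neighbours l) \o Z k) @^-1` [set a k])).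
  rewrite -prob_independent_fin_valued //; last by move=> u; exact: measurable_if_small.
  congr (fine (Pr _)); apply/funext => w /=; apply/propext.
  rewrite (@hasdegE r l w); last by move=> k; rewrite ffunE.
  by split=> [->|/eqP].
(* Within a layer the two neighbourhoods may be dependent, so the joint event is expanded over
   vectors of pairs. *)
pose p k u := fine (Pr ((if_small M (finset.set0, finset.set0)
  (fun G => (neighbours i G, neighbours j G)) \o Z k) @^-1` [set u])).
have joint : fine (Pr [set w | truncated_deg Z M i w = s /\ truncated_deg Z M j w = t]) =
    \sum_(v : {ffun 'I_m -> _} |
        hasdeg s [ffun k => (v k).1] && hasdeg t [ffun k => (v k).2]) \prod_k p k (v k).
  rewrite -(prob_independent_fin_valued
    (fun v => hasdeg s [ffun k => (v k).1] && hasdeg t [ffun k => (v k).2])) //; last first.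
    by move=> u; exact: measurable_if_small.
  congr (fine (Pr _)); apply/funext => w /=; apply/propext.
  rewrite (@hasdegE s i w); last first.
    by move=> k; rewrite !ffunE /if_small; case: ifP.
  rewrite (@hasdegE t j w); last first.
    by move=> k; rewrite !ffunE /if_small; case: ifP.
  by split=> [[-> ->]|/andP[/eqP -> /eqP]]; rewrite ?eqxx.
rewrite !marginal joint.
apply: le_trans (joint_event_dist_le (p := p) (hasdeg s) (hasdeg t)
    (fun k => neighbours_fst_marginal (Z k) M i j)
    (fun k => neighbours_snd_marginal (Z k) M i j) _ _) _.
- by move=> k u; exact: prob_ge0.
- by move=> k; apply: prob_fin_valued_sum1 => u; exact: measurable_fiber.
apply: le_trans (ler_sum _ (fun k _ => neighbours_dist_le (Zlaw k) M_gt0 ij)) _.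
by rewrite sumr_const card_ord.
Qed.

Theorem lemma2 (R : realType) (mu : R) (m : nat -> nat)
    (Pn : nat -> probability (nat * R)%type R)
    (P : probability (nat * R)%type R)
    (d : nat -> measure_display) (Omega : forall n, measurableType (d n))
    (Pr : forall n, probability (Omega n) R)
    (Z : forall n, 'I_(m n) -> {RV (Pr n) >-> (graph n * (nat * R))%type})
    (s t : nat) (M : R)
    (hmu : 0 < mu)
    (hm : m n @[n --> \oo] --> \oo)
    (hmn : ((m n)%:R / n%:R : R) @[n --> \oo] --> mu)
    (hPn : forall n, Pn n (layer_types_upto n) = 1%E)
    (hP : P layer_types = 1%E)
    (hlaw : forall n (k : 'I_(m n)), layer_law (Pr n) (Pn n) (Z n k))
    (hind : forall n, mutually_independent (Pr n) (fun k => Z n k : Omega n -> _))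
    (hweak : weakly_converges Pn P)
    (hmean : mean_size (Pn n) @[n --> \oo] --> mean_size P)
    (hmean_pos : (0 < mean_size P)%E) (hmean_fin : (mean_size P < +oo)%E)
    (hM : 0 < M)
    (hPM : (0 < P [set z : nat * R | (z.1%:R <= M)%R])%E) :
  (* nodes 1 and 2 are the ordinals 0 and 1, so the number of nodes is taken to
     be n + 2 *)
  let degree n (i : 'I_n) (w : Omega n) :=
    deg (truncated_graph (fun k => Z n k : Omega n -> _) M w) i in
  let prob n (A : set (Omega n)) : R := fine (Pr n A) in
  (prob n.+2 [set w | degree n.+2 ord0 w = s /\ degree n.+2 (inord 1) w = t]
   - prob n.+2 [set w | degree n.+2 ord0 w = s]
     * prob n.+2 [set w | degree n.+2 (inord 1) w = t]) @[n --> \oo] --> 0.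
Proof.
move=> degree prob.
pose bound n : R := M ^+ 2 / (n.+2 * n.+1)%:R *+ 8 *+ m n.+2.
have bound_cvg0 : bound n @[n --> \oo] --> 0.
  (* One factor of the denominator balances the number of layers, giving the limit [mu]; the other,
     [n.+1], gives the vanishing [harmonic n]. *)
  have -> : bound = fun n => (M ^+ 2 *+ 8 * ((m n.+2)%:R / n.+2%:R)) * harmonic n.
    apply/funext => n; rewrite /bound /harmonic /= natrM -[LHS]mulr_natr.
    by field; rewrite !lt0r_neq0 // ltr_wpDr.
  have ratio_cvg : ((m n.+2)%:R / n.+2%:R : R) @[n --> \oo] --> mu.
    by move: hmn; rewrite -(cvg_shiftn 2); under eq_fun do rewrite addn2.
  rewrite -(mulr0 (M ^+ 2 *+ 8 * mu)).
  by apply: cvgM cvg_harmonic; apply: cvgM ratio_cvg; exact: cvg_cst.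
apply/norm_cvg0P; apply: (squeeze_cvgr _ (cvg_cst 0) bound_cvg0).
near=> n; rewrite normr_ge0 /=.
apply: degree_dependence_le => //.
(* With [n.+2] nodes, [inord 1] really has value 1 and so differs from [ord0]. *)
by rewrite -val_eqE /= inordK.
Unshelve. all: by end_near.
Qed.
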